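(* Let $H=(kG)^*\#_\sigma^\tau kL$ be a cocentral abelian extension with $\sigma$ trivial. Let $g\in G$, let $V$ be a simple $kL_g$-module, and let $\tilde V=\operatorname{Ind}_{L_g}^{\tilde L_g}V$ and $\hat V=\operatorname{Ind}_{L_g}^{L}V$ (a simple $H$-module), with characters $\chi$, $\tilde\chi$, $\hat\chi$ respectively. (1) If $g^2=1$ then $\nu_H(\hat\chi)=(\tau_{g,g^{-1}}*\chi^{[2]})(\Lambda_g)$. (2) If $g$ has order at least $3$ then $\nu_H(\hat\chi)=(\tau_{g,g^{-1}}*\tilde\chi^{[2]})(\tilde\Lambda_g)-(\tau_{g,g^{-1}}*\chi^{[2]})(\Lambda_g)$.
   Context: $k$ is an algebraically closed field of characteristic not $2$; $G,L$ are finite groups with $\operatorname{char}k\nmid |G||L|$; $L$ acts on $G$ by group automorphisms, $(x,g)\mapsto x\rightharpoonup g$. Let $\{p_g\}_{g\in G}$ be the basis of $(kG)^*$ dual to $G$. A cocentral abelian extension $H=(kG)^*\#_\sigma^\tau kL$ is a Hopf algebra over $k$ with basis $\{p_g\overline{x}: g\in G,x\in L\}$, unit $\sum_g p_g\overline 1$ and structure $$p_g\overline{x}\cdot p_h\overline{y}=\delta_{g,\,x\rightharpoonup h}\,\sigma_g(x,y)\,p_g\overline{xy},\qquad \Delta(p_g\overline{x})=\sum_{h\in G}\tau_{h,h^{-1}g}(x)\,p_h\overline{x}\otimes p_{h^{-1}g}\overline{x},\qquad \varepsilon(p_g\overline x)=\delta_{g,1},$$ for nonzero scalars $\sigma_g(x,y),\tau_{g,h}(x)\in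 k$ with $\sigma_g(1,x)=\sigma_g(x,1)=1$. ''$\sigma$ trivial'' means all $\sigma_g(x,y)=1$. Such $H$ and $H^*$ are semisimple. Schur indicator: let $\Lambda$ be the unique integral of $H$ with $\varepsilon(\Lambda)=1$, $\Lambda^{[2]}=\sum\Lambda_1\Lambda_2$; for an $H$-module with character $\chi$, $\nu_H(\chi)=\chi(\Lambda^{[2]})$. Notation: $L_{g,h}=\{y\in L: y\rightharpoonup g=h\}$; $L_g=L_{g,g}$; $\tilde L_g=L_g\cup L_{g,g^{-1}}$ (a subgroup of $L$ with $[\tilde L_g:L_g]\le 2$). With $\sigma$ trivial, for a $kL_g$-module $V$ the space $\hat V=kL\otimes_{kL_g}V$ is an $H$-module via $(p_h\overline x)\cdot(y\otimes v)=\delta_{xy\rightharpoonup g,\,h}\,xy\otimes v$. $\Lambda_g=\frac1{|L_g|}\sum_{z\in L_g}z\in kL_g$ and $\tilde\Lambda_g=\frac1{|\tilde L_g|}\sum_{z\in\tilde L_g}z\in k\tilde L_g$. The product $*$ is convolution of functionals, i.e. $(\alpha*\beta)(z)=\alpha(z)\beta(z)$ on group elements $z$, extended linearly; for a functional $\chi$ on a group algebra, $\chi^{[2]}$ is the functional with $\chi^{[2]}(z)=\chi(z^2)$ for group elements $z$. $\tau_{g,g^{-1}}$ is regarded as the functional $z\mapsto\tau_{g,g^{-1}}(z)$ on $kL_g$ or $k\tilde L_g$. *)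

(* Defs.v *)
From HB Require Import structures.
From mathcomp Require Import all_boot all_order all_algebra all_fingroup.
From mathcomp Require Import mxrepresentation.

Set Implicit Arguments.
Unset Strict Implicit.
Unset Printing Implicit Defensive.

Import GRing.Theory.
Local Open Scope ring_scope.

(* The k-space with basis B.  The tensor product of the spaces with bases B and
   C is represented as the space with basis B * C. *)
Notation freemod k B := {ffun B -> GRing.regular k}.

Section FreeModules.
Variable k : fieldType.
Implicit Types B C : finType.

Definition dl B (b : B) : freemod k B := [ffun c => (c == b)%:R].

(* Linear extension of a map defined on the basis. *)
Definition ext B (V : lmodType k) (f : B -> V) (u : freemod k B) : V :=
  \sum_b (u b : k) *: f b.

Definition ten B C (u : freemod k B) (v : freemod k C) : freemod k (B * C)%type
  := [ffun p => u p.1 * v p.2].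

(* The tensor product of the linear extensions of f and h. *)
Definition ften B B' C C' (f : B -> freemod k B') (h : C -> freemod k C') :
  freemod k (B * C)%type -> freemod k (B' * C')%type :=
  ext (fun p => ten (f p.1) (h p.2)).

Lemma ext_linear B (V : lmodType k) (f : B -> V) : linear (ext f).
Proof.
move=> a u v; rewrite /ext scaler_sumr -big_split /=.
by apply: eq_bigr => b _; rewrite !ffunE scalerDl scalerA.
Qed.
HB.instance Definition _ B V f := GRing.isSemilinear.Build k _ _ _
  (@ext B V f) (GRing.semilinear_linear (@ext_linear B V f)).

Lemma ext_dl B (V : lmodType k) (f : B -> V) b : ext f (dl b) = f b.
Proof.
rewrite /ext (bigD1 b) //= ffunE eqxx scale1r big1 ?addr0 // => c /negPf nc.
by rewrite ffunE nc scale0r.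
Qed.

End FreeModules.

Section HopfAlgebras.
Variable k : fieldType.

(* Structure maps of a bialgebra with basis B, given on the basis. *)
Record bialg_data (B : finType) := BialgData {
  bmul : B -> B -> freemod k B;
  bone : freemod k B;
  bcomul : B -> freemod k (B * B)%type;
  bcounit : B -> k }.

Variables (B : finType) (A : bialg_data B).

(* The product as a linear map on the tensor square. *)
Definition tenmul : freemod k (B * B)%type -> freemod k B :=
  ext (fun p => bmul A p.1 p.2).

Definition hmul (u v : freemod k B) : freemod k B := tenmul (ten u v).

Lemma hmulE u v : hmul u v = \sum_b \sum_c (u b * v c : k) *: bmul A b c.
Proof.
by rewrite pair_bigA; apply: eq_bigr => -[b c] _; rewrite ffunE.
Qed.

Definition hcomul : freemod k B -> freemod k (B * B)%type := ext (bcomul A).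

Definition hcounit : freemod k B -> k := ext (bcounit A : B -> k^o).

(* The product of the algebra structure on the tensor square. *)
Definition hmul2 (s t : freemod k (B * B)%type) : freemod k (B * B)%type :=
  ext (fun p => ext (fun q => ten (bmul A p.1 q.1) (bmul A p.2 q.2)) t) s.

Definition is_antipode (S : B -> freemod k B) : Prop := forall u,
  tenmul (ften S (@dl k B) (hcomul u)) = hcounit u *: bone A /\
  tenmul (ften (@dl k B) S (hcomul u)) = hcounit u *: bone A.

Record is_hopf : Prop := IsHopf {
  hopf_mulA : forall u v w, hmul u (hmul v w) = hmul (hmul u v) w;
  hopf_mul1l : forall u, hmul (bone A) u = u;
  hopf_mul1r : forall u, hmul u (bone A) = u;
  hopf_comulA : forall u (a b c : B),
    ften (bcomul A) (@dl k B) (hcomul u) ((a, b), c) =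
    ften (@dl k B) (bcomul A) (hcomul u) (a, (b, c));
  hopf_counitl : forall u,
    ext (fun p => bcounit A p.1 *: dl k p.2) (hcomul u) = u;
  hopf_counitr : forall u,
    ext (fun p => bcounit A p.2 *: dl k p.1) (hcomul u) = u;
  hopf_comulM : forall u v, hcomul (hmul u v) = hmul2 (hcomul u) (hcomul v);
  hopf_comul1 : hcomul (bone A) = ten (bone A) (bone A);
  hopf_counitM : forall u v, hcounit (hmul u v) = hcounit u * hcounit v;
  hopf_counit1 : hcounit (bone A) = 1;
  hopf_antipode : exists S, is_antipode S }.

(* There is at most one normalized (two-sided) integral. *)
Record normalized_integral (Lam : freemod k B) : Prop := NormalizedIntegral {
  integral_left : forall u, hmul u Lam = hcounit u *: Lam;
  integral_right : forall u, hmul Lam u = hcounit u *: Lam;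
  integral_norm : hcounit Lam = 1 }.

Lemma normalized_integral_uniq (Lam Lam' : freemod k B) :
  normalized_integral Lam -> normalized_integral Lam' -> Lam = Lam'.
Proof.
move=> [_ r e] [l' _ e'].
by rewrite -[RHS]scale1r -e -l' r e' scale1r.
Qed.

Definition sweedler_square (u : freemod k B) : freemod k B :=
  tenmul (hcomul u).

(* The Schur indicator of the character chi, with Lam the normalized
   integral. *)
Definition schur_indicator (Lam : freemod k B) (chi : freemod k B -> k) : k :=
  chi (sweedler_square Lam).

Record is_module (W : vectType k) (rho : freemod k B -> 'End(W)) : Prop :=
  IsModule {
  module_linear : linear rho;
  module_one : rho (bone A) = \1%VF;
  module_mul : forall u v, rho (hmul u v) = (rho u \o rho v)%VF }.

End HopfAlgebras.

Section Endomorphisms.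
Variables (k : fieldType) (W : vectType k).

Definition lftrace (f : 'End(W)) : k :=
  \sum_i coord (vbasis {:W}) i (f (vbasis {:W})`_i).

(* The quotient of W by U, realized on a complement of U, with the projection
   along U as canonical surjection. *)
Variable U : {vspace W}.

Definition vquot := subvs_of (U^C)%VS.

Definition vquot_pi : 'Hom(W, vquot) :=
  linfun (vsproj (U^C)%VS \o daddv_pi (U^C)%VS U).

Lemma capUC0 : (U^C :&: U = 0)%VS.
Proof. by rewrite capvC capv_compl. Qed.

Lemma vquot_piE w : vsval (vquot_pi w) = daddv_pi (U^C)%VS U w.
Proof. by rewrite lfunE /= vsprojK ?memv_pi. Qed.

Lemma vquot_pi_ker : lker vquot_pi = U.
Proof.
apply/vspaceP => w; rewrite memv_ker -(inj_eq val_inj) /= vquot_piE.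
have dec : daddv_pi (U^C)%VS U w + daddv_pi U (U^C)%VS w = w.
  by apply: daddv_pi_add (capUC0) _; rewrite addvC addv_complf memvf.
apply/eqP/idP => [p0 | wU].
  by rewrite -dec p0 add0r memv_pi.
have : daddv_pi (U^C)%VS U w \in (U^C :&: U)%VS.
  rewrite memv_cap memv_pi /=.
  suff -> : daddv_pi (U^C)%VS U w = w - daddv_pi U (U^C)%VS w.
    by rewrite memvB ?memv_pi.
  by rewrite -[X in X - _]dec addrK.
by rewrite capUC0 memv0 => /eqP.
Qed.

Lemma vquot_pi_section (w : vquot) : vquot_pi (vsval w) = w.
Proof.
by apply: val_inj; rewrite /= vquot_piE daddv_pi_id ?capUC0 ?subvsP.
Qed.

(* The endomorphism of W / U induced by f; meaningful if f stabilizes U. *)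
Definition vquot_end (f : 'End(W)) : 'End(vquot) :=
  (vquot_pi \o f \o linfun vsval)%VF.

Lemma vquot_endE (f : 'End(W)) w :
  (f @: U <= U)%VS -> vquot_end f (vquot_pi w) = vquot_pi (f w).
Proof.
move=> fU; rewrite !comp_lfunE [linfun vsval _]lfunE /=.
move: (vquot_pi_section (vquot_pi w)); set w0 := vsval _ => w0E.
apply/eqP; rewrite -subr_eq0 -!linearB /= -memv_ker vquot_pi_ker.
apply: (subvP fU); apply: memv_img.
by rewrite -[in X in _ \in X]vquot_pi_ker memv_ker linearB /= w0E subrr.
Qed.

End Endomorphisms.

(* For a representation rV of S, viewed as the left kS-module 'cV_n, and
   S \subset T, the left kT-module kT (x)_kS V: the quotient of the space
   kT (x)_k V of functions from T to V by the elements
   yz (x) v - y (x) zv for y in T and z in S. *)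
Section Induction.
Variables (k : fieldType) (lT : finGroupType) (S T : {group lT}).
Variables (n : nat) (rV : mx_representation k S n).

Definition preind := {ffun subg_of T -> 'cV[k]_n}.

Definition pretensor_fun (y : subg_of T) (v : 'cV[k]_n) : preind :=
  [ffun y' => if y' == y then v else 0].

Lemma pretensor_fun_linear y : linear (pretensor_fun y).
Proof.
move=> a u v; apply/ffunP=> y'; rewrite !ffunE.
by case: eqP; rewrite // scaler0 addr0.
Qed.
HB.instance Definition _ y := GRing.isSemilinear.Build k _ _ _
  (pretensor_fun y) (GRing.semilinear_linear (pretensor_fun_linear y)).

Definition pretensor (y : subg_of T) : 'Hom('cV[k]_n, preind) :=
  linfun (pretensor_fun y).

Definition ind_relations : {vspace preind} :=
  (\sum_(y : subg_of T) \sum_(z in S)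
     limg (pretensor (y * subg T z)%g
           - (pretensor y \o linfun (mulmx (rV z))))%VF)%VS.

Definition ind := vquot ind_relations.

Definition tensor (y : subg_of T) (v : 'cV[k]_n) : ind :=
  vquot_pi ind_relations (pretensor y v).

Lemma tensor_balanced (y : subg_of T) (z : lT) (v : 'cV[k]_n) :
  z \in S -> tensor (y * subg T z)%g v = tensor y (rV z *m v).
Proof.
move=> zS; apply/eqP; rewrite -subr_eq0 -raddfB /= -memv_ker vquot_pi_ker.
have -> : pretensor (y * subg T z)%g v - pretensor y (rV z *m v) =
    (pretensor (y * subg T z)%g
     - (pretensor y \o linfun (mulmx (rV z))))%VF v.
  by rewrite add_lfunE opp_lfunE comp_lfunE [linfun (mulmx _) v]lfunE.
apply: subvP _ _ (memv_img _ (memvf v)); apply: (sumv_sup y) => //.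
exact: (sumv_sup z).
Qed.

Lemma tensor_span (w : ind) : exists F : preind, w = \sum_y tensor y (F y).
Proof.
exists (vsval w); rewrite -[LHS]vquot_pi_section.
rewrite -raddf_sum /=; congr (vquot_pi _ _).
apply/ffunP=> y; rewrite sum_ffunE (bigD1 y) //= lfunE /= ffunE eqxx.
rewrite big1 ?addr0 // => y' /negPf ny.
by rewrite lfunE /= ffunE eq_sym ny.
Qed.

(* The linear extension of y (x) v |-> c y *: (s y (x) v). *)
Definition pretensor_map (c : subg_of T -> k) (s : subg_of T -> subg_of T)
  (F : preind) : preind := \sum_y c y *: pretensor (s y) (F y).

Lemma pretensor_map_linear c s : linear (pretensor_map c s).
Proof.
move=> a F F'; rewrite /pretensor_map scaler_sumr -big_split /=.
apply: eq_bigr => y _.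
by rewrite !ffunE linearP scalerDr !scalerA mulrC.
Qed.
HB.instance Definition _ c s := GRing.isSemilinear.Build k _ _ _
  (pretensor_map c s) (GRing.semilinear_linear (pretensor_map_linear c s)).

Definition tensor_map c s : 'End(ind) :=
  vquot_end ind_relations (linfun (pretensor_map c s)).

Lemma pretensor_mapE c s y v :
  pretensor_map c s (pretensor y v) = c y *: pretensor (s y) v.
Proof.
rewrite /pretensor_map (bigD1 y) //= [pretensor y v]lfunE /= ffunE eqxx.
rewrite big1 ?addr0 // => y' /negPf ny.
by rewrite ffunE ny linear0 scaler0.
Qed.

Lemma tensor_mapE c s y v :
    (forall y z, z \in S -> c (y * subg T z)%g = c y) ->
    (forall y z, z \in S -> s (y * subg T z)%g = (s y * subg T z)%g) ->
  tensor_map c s (tensor y v) = c y *: tensor (s y) v.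
Proof.
move=> cS sS; rewrite /tensor_map /tensor vquot_endE.
  by rewrite [linfun (pretensor_map c s) _]lfunE /= pretensor_mapE linearZ.
rewrite /ind_relations limg_sum; apply/subv_sumP => y' _.
rewrite limg_sum; apply/subv_sumP => z zS.
apply/subvP => _ /memv_imgP[_ /memv_imgP[u _ ->] ->].
rewrite add_lfunE opp_lfunE comp_lfunE [linfun (mulmx _) _]lfunE /=.
rewrite lfunE /= raddfB /= !pretensor_mapE cS // sS // -scalerBr memvZ //.
rewrite -/ind_relations -[ind_relations]vquot_pi_ker memv_ker linearB /=.
by rewrite subr_eq0; apply/eqP/tensor_balanced.
Qed.

Definition ind_act (x : lT) : 'End(ind) :=
  tensor_map (fun=> 1) (fun y => (subg T x * y)%g).

Definition ind_char (x : lT) : k := lftrace (ind_act x).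

Lemma ind_actE x y v : ind_act x (tensor y v) = tensor (subg T x * y)%g v.
Proof. by rewrite tensor_mapE ?scale1r // => y' z _; rewrite mulgA. Qed.

End Induction.

Section GroupAlgebra.
Variables (k : fieldType) (lT : finGroupType).

(* A functional on the group algebra of S is given by its values on group
   elements, its values outside S being irrelevant; its linear extension is
   evaluated at elements of the group algebra by ext. *)
Definition falg_eval (f : lT -> k) (a : freemod k lT) : k :=
  ext (f : lT -> k^o) a.

Definition conv (f h : lT -> k) : lT -> k := fun z => f z * h z.

Definition adams2 (f : lT -> k) : lT -> k := fun z => f (z ^+ 2)%g.

Definition gavg (S : {set lT}) : freemod k lT :=
  #|S|%:R^-1 *: \sum_(z in S) dl k z.

Definition rep_char (S : {group lT}) n (rV : mx_representation k S n) :
  lT -> k := fun z => \tr (rV z).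

End GroupAlgebra.

Section CocentralExtensions.
Variables (k : fieldType) (gT lT : finGroupType).
Variable to : groupAction [set: lT] [set: gT].

(* The actions of the library are right actions; this is the corresponding
   left action. *)
Definition lact (x : lT) (g : gT) : gT := to g (x^-1)%g.

Lemma lact1 g : lact 1%g g = g.
Proof. by rewrite /lact invg1 act1. Qed.

Lemma lactM x y g : lact (x * y)%g g = lact x (lact y g).
Proof. by rewrite /lact invMg actMin ?inE. Qed.

Lemma lactK x : cancel (lact x) (lact x^-1%g).
Proof. by move=> g; rewrite -lactM mulVg lact1. Qed.

Lemma lactMg x g h : lact x (g * h)%g = (lact x g * lact x h)%g.
Proof. by rewrite /lact gactM ?inE. Qed.

Lemma lactV x g : lact x (g^-1)%g = ((lact x g)^-1)%g.
Proof. by rewrite /lact gactV ?inE. Qed.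

Definition transporter (g h : gT) : {set lT} := [set y | lact y g == h].

Definition stab g := transporter g g.

Lemma stab_group_set g : group_set (stab g).
Proof.
apply/group_setP; split=> [|x y]; first by rewrite inE lact1.
by rewrite !inE => /eqP xg /eqP yg; rewrite lactM yg xg.
Qed.
Canonical stab_group g := Group (stab_group_set g).

Definition xstab g : {set lT} := stab g :|: transporter g (g^-1)%g.

Lemma xstab_group_set g : group_set (xstab g).
Proof.
apply/group_setP; split=> [|x y]; first by rewrite !inE lact1 eqxx.
rewrite !inE lactM => xg /orP[] /eqP->; first by [].
by rewrite lactV; case/orP: xg => /eqP->; rewrite ?invgK eqxx ?orbT.
Qed.
Canonical xstab_group g := Group (xstab_group_set g).

Lemma stab_sub_xstab g : stab g \subset xstab g.
Proof. exact: subsetUl. Qed.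

Variables (sigma : gT -> lT -> lT -> k) (tau : gT -> gT -> lT -> k).

(* The pair (g, x) stands for the basis element p_g # x. *)
Definition cocentral : bialg_data k (gT * lT)%type := BialgData
  (fun b c => if b.1 == lact b.2 c.1
              then sigma b.1 b.2 c.2 *: dl k (b.1, (b.2 * c.2)%g) else 0)
  (\sum_g dl k (g, 1%g))
  (fun b => \sum_h tau h (h^-1 * b.1)%g b.2 *:
              ten (dl k (h, b.2)) (dl k ((h^-1 * b.1)%g, b.2)))
  (fun b => (b.1 == 1%g)%:R).

Record cocentral_extension : Prop := CocentralExtension {
  sigma_neq0 : forall g x y, sigma g x y != 0;
  tau_neq0 : forall g h x, tau g h x != 0;
  sigma_1l : forall g x, sigma g 1%g x = 1;
  sigma_1r : forall g x, sigma g x 1%g = 1;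
  cocentral_hopf : is_hopf cocentral }.

Lemma cocentral_integral :
    (forall h x y, sigma h x y = 1) -> #|lT|%:R != 0 :> k ->
  normalized_integral cocentral
    (#|lT|%:R^-1 *: \sum_(x : lT) dl k (1%g : gT, x)).
Proof.
move=> sigma1 nz; set Lam := _ *: _.
have LamE q y : Lam (q, y) = (q == 1%g)%:R * #|lT|%:R^-1.
  rewrite ffunE sum_ffunE (bigD1 y) //= ffunE xpair_eqE eqxx andbT.
  rewrite big1 ?addr0 => [|z /negPf nz']; first by rewrite mulrC.
  by rewrite ffunE xpair_eqE [y == z]eq_sym nz' andbF.
have lact_1 x : lact x 1%g = 1%g by rewrite /lact gact1 ?inE.
have lact_eq1 x q : (1%g == lact x q) = (q == 1%g).
  by rewrite -{1}(lact_1 x) (can_eq (lactK x)) eq_sym.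
split.
- move=> u; rewrite hmulE /hcounit /ext scaler_suml; apply: eq_bigr.
  case=> p x _ /=.
  transitivity (u (p, x) *: ((p == 1%g)%:R *: Lam));
    last exact: scalerA.
  transitivity (\sum_q \sum_y ((u (p, x) * Lam (q, y) : k) *:
     (if p == lact x q then sigma p x y *: dl k (p, (x * y)%g) else 0))).
    by rewrite pair_bigA; apply: eq_bigr => -[].
  rewrite (bigD1 1%g) //= [X in _ + X]big1 ?addr0 => [|q /negPf nq]; last first.
    by apply: big1 => y _; rewrite LamE nq mul0r mulr0 scale0r.
  rewrite lact_1; case: eqP => [-> | _]; last first.
    by rewrite scale0r scaler0 big1 // => y _; rewrite scaler0.
  rewrite scale1r [in RHS]/Lam scaler_sumr scaler_sumr.
  rewrite [RHS](reindex_inj (mulgI x)).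
  apply: eq_bigr => y _.
  by rewrite LamE eqxx mul1r sigma1 scale1r scalerA.
- move=> u; rewrite hmulE exchange_big /hcounit /ext scaler_suml.
  apply: eq_bigr; case=> q y _ /=.
  transitivity (u (q, y) *: ((q == 1%g)%:R *: Lam));
    last exact: scalerA.
  transitivity (\sum_p \sum_x ((Lam (p, x) * u (q, y) : k) *:
     (if p == lact x q then sigma p x y *: dl k (p, (x * y)%g) else 0))).
    by rewrite pair_bigA; apply: eq_bigr => -[].
  rewrite (bigD1 1%g) //= [X in _ + X]big1 ?addr0 => [|p /negPf np]; last first.
    by apply: big1 => x _; rewrite LamE np !mul0r scale0r.
  case: (q =P 1%g) => [-> | /eqP/negPf nq]; last first.
    rewrite scale0r scaler0 big1 // => x _.
    by rewrite lact_eq1 nq scaler0.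
  rewrite scale1r [in RHS]/Lam scaler_sumr scaler_sumr.
  rewrite [RHS](reindex_inj (mulIg y)).
  apply: eq_bigr => x _.
  by rewrite LamE eqxx mul1r lact_eq1 eqxx sigma1 scale1r scalerA mulrC.
- rewrite /hcounit linearZ linear_sum /=.
  under eq_bigr do rewrite ext_dl /= eqxx.
  by rewrite sumr_const; apply: mulVf.
Qed.

Variables (g : gT) (n : nat) (rV : mx_representation k (stab_group g) n).

Definition hat := @ind k lT (stab_group g) [set: lT]%G n rV.

Definition hat_act_basis (b : gT * lT) : 'End(hat) :=
  tensor_map rV (fun y => (lact (b.2 * sgval y)%g g == b.1)%:R)
                (fun y => (subg [set: lT]%G b.2 * y)%g).

Definition hat_act : freemod k (gT * lT)%type -> 'End(hat) :=
  ext hat_act_basis.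

Definition hat_char (u : freemod k (gT * lT)%type) : k := lftrace (hat_act u).

Lemma hat_act_basisE h x y v :
  hat_act_basis (h, x) (tensor rV y v) =
  (lact (x * sgval y)%g g == h)%:R *: tensor rV (subg [set: lT]%G x * y)%g v.
Proof.
rewrite tensor_mapE // => y' z /=; last by rewrite mulgA.
rewrite inE => /eqP zg; rewrite subgK ?inE //.
by rewrite !lactM zg.
Qed.

Lemma hat_module : (forall h x y, sigma h x y = 1) ->
  is_module cocentral hat_act.
Proof.
have hat_eq (f h : 'End(hat)) :
    (forall y v, f (tensor rV y v) = h (tensor rV y v)) -> f = h.
  move=> fh; apply/lfunP => w; have [F ->] := tensor_span w.
  by rewrite !linear_sum; apply: eq_bigr => y _; apply: fh.
move=> sigma1; split.
- exact: ext_linear.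
- apply: hat_eq => y v; rewrite /hat_act /= linear_sum /= sum_lfunE id_lfunE.
  rewrite (bigD1 (lact (sgval y) g)) //= ext_dl hat_act_basisE mul1g eqxx.
  rewrite scale1r morph1 mul1g big1 ?addr0 // => h /negPf nh.
  by rewrite ext_dl hat_act_basisE mul1g eq_sym nh scale0r.
- move=> u w.
  have basisM b c : hat_act (bmul cocentral b c) =
      (hat_act_basis b \o hat_act_basis c)%VF.
    case: b c => [p x] [q y] /=; apply: hat_eq => z v.
    rewrite comp_lfunE hat_act_basisE linearZ /= hat_act_basisE scalerA.
    rewrite /= subgK ?inE // !lactM.
    case: eqP => [-> | ne].
      rewrite sigma1 scale1r /hat_act ext_dl hat_act_basisE !lactM.
      rewrite (can_eq (lactK x)) morphM ?inE // mulgA.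
      by case: eqP => _; rewrite ?mul1r ?mul0r ?scale0r // eqxx.
    rewrite /hat_act linear0 lfunE /=.
    case: eqP => [-> | _]; last by rewrite mul0r scale0r.
    by rewrite mul1r; case: eqP => [e|]; rewrite ?scale0r //; case: ne.
  apply/lfunP => t; rewrite comp_lfunE /hmul /tenmul /hat_act.
  rewrite [ext _ (ten u w)]/ext linear_sum /= !sum_lfunE.
  transitivity (\sum_b \sum_c
      ext hat_act_basis (ten u w (b, c) *: bmul cocentral b c) t).
    by rewrite pair_bigA; apply: eq_bigr => -[].
  apply: eq_bigr => b _; rewrite scale_lfunE linear_sum scaler_sumr.
  apply: eq_bigr => c _; rewrite ffunE linearZ /= -/(hat_act _) basisM.
  by rewrite !scale_lfunE comp_lfunE linearZ scalerA.
Qed.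

End CocentralExtensions.

(* Main.v *)
(* A permutation-like endomorphism of an induced module kT (x)_kS V has the
   usual induced-character trace; this is proved by composing with the
   averaging operator over S on functions T -> V.  Expanding the normalized
   integral |L|^-1 sum_x p_1 # x, the indicator of the module induced from V
   becomes a sum over y in L and z with z.g = g^-1 of
   tau_{yg,(yg)^-1}(y z y^-1) chi(z^2).  The bialgebra axioms say that
   x |-> tau_{.,.}(x) is a twisted homomorphism with values in normalized
   2-cocycles of G, so tau_{g,g^-1} = tau_{g^-1,g} and the summand does not
   depend on y: the indicator is |L_g|^-1 times the sum of
   tau_{g,g^-1}(z) chi(z^2) over L_{g,g^-1}.  This is (1) when g = g^-1;
   otherwise the term with chi_tilde is the same sum over the disjoint union
   of L_g and L_{g,g^-1}. *)
From HB Require Import structures.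
Require Import Defs.
From mathcomp Require Import all_boot all_order all_algebra all_fingroup.
From mathcomp Require Import cyclic mxrepresentation.

Set Implicit Arguments.
Unset Strict Implicit.
Unset Printing Implicit Defensive.

Import GRing.Theory.
Local Open Scope ring_scope.

(* The [e j] need not be a basis, so that the spanning family of the pure tensors
   can be used directly. *)
Lemma lftrace_span (k : fieldType) (W : vectType k) (J : finType) (e : J -> W)
    (phi : J -> W -> k) (f : 'End(W)) :
    (forall j, linear (phi j : W -> k^o)) ->
    (forall w, w = \sum_j phi j w *: e j) ->
  lftrace f = \sum_j phi j (f (e j)).
Proof.
move=> phiL decW; rewrite /lftrace; set b := vbasis _.
have phi_coord j w :
    phi j w = \sum_i coord b i w * phi j (b`_i).
  pose L := linfun (HB.pack (phi j : W -> k^o)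
    (GRing.isSemilinear.Build k W k^o _ _ (GRing.semilinear_linear (phiL j)))
    : {linear W -> k^o}).
  have LE v : phi j v = L v by rewrite lfunE.
  rewrite LE {1}(coord_vbasis (memvf w)) linear_sum /=.
  by apply: eq_bigr => i _; rewrite linearZ LE.
(* Expanding the basis vectors in the family [e] on one side, and each [f (e j)] in the basis on the
   other, gives the same double sum. *)
transitivity (\sum_(i < \dim {:W}) \sum_j phi j b`_i * coord b i (f (e j))).
  apply: eq_bigr => i _; rewrite {1}(decW b`_i) !linear_sum.
  by apply: eq_bigr => j _; rewrite !linearZ.
rewrite exchange_big; apply: eq_bigr => j _; rewrite phi_coord.
by apply: eq_bigr => i _; rewrite mulrC.
Qed.

(** * Traces on induced modules *)

Section InducedTrace.
Variables (k : fieldType) (lT : finGroupType) (S T : {group lT}).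
Variables (n : nat) (rV : mx_representation k S n).

(** When [#|S|] is invertible this projects onto the functions with [F (y * z) = rV z^-1 *m F y] for
    [z] in [S], a concrete model of the induced module; the entries of the averaged function then
    serve as coordinates on the quotient. *)
Definition ind_avg (F : preind k T n) : preind k T n :=
  [ffun y => #|S|%:R^-1 *: \sum_(z in S) rV z *m F (y * subg T z)%g].

Lemma ind_avg_linear : linear ind_avg.
Proof.
move=> a F F'; apply/ffunP => y; rewrite !ffunE.
rewrite scalerA [a * _]mulrC -scalerA -scalerDr.
congr (_ *: _); rewrite scaler_sumr -big_split /=; apply: eq_bigr => z _.
by rewrite !ffunE mulmxDr scalemxAr.
Qed.
HB.instance Definition _ := GRing.isSemilinear.Build k _ _ _
  ind_avg (GRing.semilinear_linear ind_avg_linear).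

Lemma vquot_pi_sum (F : preind k T n) :
  vquot_pi (ind_relations T rV) F = \sum_y tensor rV y (F y).
Proof.
rewrite -raddf_sum /=; congr (vquot_pi _ _).
apply/ffunP => y; rewrite sum_ffunE (bigD1 y) //= lfunE /= ffunE eqxx.
rewrite big1 ?addr0 // => y' /negPf ny.
by rewrite lfunE /= ffunE eq_sym ny.
Qed.

Hypothesis S_neq0 : #|S|%:R != 0 :> k.

(** Balancedness moves [rV z] to the left tensor factor, so after translating [y] by [z] each [z]
    contributes the whole sum of tensors, and there are [#|S|] of them. *)
Lemma vquot_pi_avg (F : preind k T n) :
  vquot_pi (ind_relations T rV) (ind_avg F) = vquot_pi (ind_relations T rV) F.
Proof.
rewrite !vquot_pi_sum.
transitivity (#|S|%:R^-1 *: \sum_(z in S) \sum_(y : subg_of T)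
    tensor rV y (F y)).
  rewrite (eq_bigr (fun y => #|S|%:R^-1 *: \sum_(z in S)
      tensor rV (y * subg T z)%g (F (y * subg T z)%g))).
    rewrite -scaler_sumr exchange_big; congr (_ *: _).
    apply: eq_bigr => z _.
    by rewrite [RHS](reindex_inj (mulIg (subg T z))).
  move=> y _; rewrite ffunE /tensor !linearZ /= !linear_sum /=.
  apply: eq_bigr => z zS; congr (_ *: _); exact/esym/tensor_balanced.
by rewrite sumr_const -[X in _ *: X]scaler_nat scalerA mulVf // scale1r.
Qed.

Hypothesis sST : S \subset T.

(** The substitution of [z' * z] for [z'] in the average turns the contribution of [yz (x) v] into
    that of [y (x) zv]. Hence averaging factors through the quotient. *)
Lemma ind_avg_relations (F : preind k T n) :
  F \in ind_relations T rV -> ind_avg F = 0.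
Proof.
suff sub : (ind_relations T rV <= lker (linfun ind_avg))%VS.
  by move/(subvP sub); rewrite memv_ker lfunE => /eqP.
apply/subv_sumP => y _; apply/subv_sumP => z zS.
apply/subvP => _ /memv_imgP[v _ ->].
rewrite memv_ker add_lfunE opp_lfunE comp_lfunE [linfun (mulmx _) v]lfunE.
rewrite linearB subr_eq0 /= !lfunE /=.
apply/eqP/ffunP => y'; rewrite !ffunE; congr (_ *: _).
rewrite (reindex_inj (mulIg z)) (eq_bigl (mem S)) => [|z']; last first.
  by rewrite groupMr.
apply: eq_bigr => z' z'S.
rewrite !ffunE morphM ?(subsetP sST) // mulgA (inj_eq (mulIg _)).
by case: eqP; rewrite ?mulmx0 // repr_mxM // mulmxA.
Qed.

(** The representative chosen by [vsval] is not explicit, but it differs from the pure tensor by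
    relations, which averaging kills. *)
Lemma ind_avg_tensor y v :
  ind_avg (vsval (tensor rV y v)) = ind_avg (pretensor k n y v).
Proof.
apply/eqP; rewrite -subr_eq0 -linearB; apply/eqP/ind_avg_relations.
rewrite -{2}[ind_relations T rV]vquot_pi_ker memv_ker linearB /=.
by rewrite vquot_pi_section subrr.
Qed.

(** The trace is taken along the spanning family [y (x) e_i], with the entries of [ind_avg] as
    coordinates. Summing over all [y] in [T] instead of coset representatives is what the factor
    [#|S|^-1] compensates. *)
Lemma lftrace_tensor_map (c : subg_of T -> k) (x : lT) :
    x \in T -> (forall y z, z \in S -> c (y * subg T z)%g = c y) ->
  lftrace (tensor_map rV c (fun y => subg T x * y)%g) =
  #|S|%:R^-1 *
    \sum_(y in T | (x ^ y)%g \in S) c (subg T y) * \tr (rV (x ^ y)%g).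
Proof.
move=> xT cS.
pose e (p : subg_of T * 'I_n) := tensor rV p.1 (delta_mx p.2 0).
pose phi (p : subg_of T * 'I_n) (w : ind T rV) : k :=
  ind_avg (vsval w) p.1 p.2 0.
rewrite (@lftrace_span _ _ _ e phi) => [||w]; first last.
- rewrite -{1}[w]vquot_pi_section -vquot_pi_avg vquot_pi_sum.
  rewrite -(pair_bigA _ (fun y i => phi (y, i) w *: e (y, i))) /=.
  apply: eq_bigr => y _; rewrite {1}[ind_avg _ y]matrix_sum_delta.
  rewrite /tensor !linear_sum /=; apply: eq_bigr => i _.
  by rewrite big_ord1 !linearZ.
- move=> p a u v; rewrite /phi !linearP /= ffunE mxE; congr (_ + _).
  by rewrite ffunE mxE.
set f := tensor_map _ _ _.
rewrite -(pair_bigA _ (fun y i => phi (y, i) (f (e (y, i))))) /=.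
transitivity (\sum_(y : subg_of T) #|S|%:R^-1 *
    (if (x ^ sgval y)%g \in S then c y * \tr (rV (x ^ sgval y)%g) else 0)).
  apply: eq_bigr => y _.
  (* The image of [y (x) v] sits at [xy], so the average at [y] sees it only through [z = x ^ y]. *)
  have eqxy : {in S, forall z,
      (y * subg T z == subg T x * y)%g = (z == (x ^ sgval y)%g)}.
    move=> z zS.
    rewrite -(inj_eq (mulgI (sgval y)) z (x ^ sgval y)%g) -conjgC.
    by rewrite -val_eqE /= !subgK // (subsetP sST).
  have phiE i : phi (y, i) (f (e (y, i))) = #|S|%:R^-1 * (c y *
      if (x ^ sgval y)%g \in S then rV (x ^ sgval y)%g i i else 0).
    rewrite /phi /e /f tensor_mapE //= => [|y' z _]; last by rewrite mulgA.
    rewrite linearZ /= ind_avg_tensor.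
    rewrite ffunE mxE ffunE mxE summxE mulrCA.
    congr (_ * (_ * _)).
    have [xyS|/negP xyS] := ifPn.
      rewrite (bigD1 (x ^ sgval y)%g) //= big1 => [|z /andP[zS /negPf nz]].
        by rewrite addr0 lfunE /= ffunE eqxy // eqxx -colE mxE.
      by rewrite lfunE /= ffunE eqxy // nz mulmx0 mxE.
    rewrite big1 // => z zS; rewrite lfunE /= ffunE eqxy //.
    by case: eqP => [ez|_]; [case: xyS; rewrite -ez | rewrite mulmx0 mxE].
  under eq_bigr do rewrite phiE.
  rewrite -!mulr_sumr; congr (_ * _); case: ifP => // _.
  by rewrite big1 ?mulr0.
rewrite -mulr_sumr; congr (_ * _); rewrite -big_mkcond /=.
rewrite [RHS](reindex_onto sgval (subg T)) => [|y /andP[yT _]]; last first.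
  exact: subgK.
by apply: eq_big => y; rewrite ?sgvalK ?subgP ?eqxx ?andbT.
Qed.

End InducedTrace.

Lemma ten_dl (k : fieldType) (B C : finType) (b : B) (c : C) :
  ten (dl k b) (dl k c) = dl k (b, c).
Proof.
apply/ffunP => -[x y]; rewrite !ffunE xpair_eqE /=.
by case: eqP; case: eqP; rewrite ?mulr1 ?mulr0.
Qed.

(** * Identities for [tau] from the bialgebra axioms *)

Section TauIdentities.
Variables (k : fieldType) (gT lT : finGroupType).
Variable to : groupAction [set: lT] [set: gT].
Variables (sigma : gT -> lT -> lT -> k) (tau : gT -> gT -> lT -> k).
Hypothesis hH : cocentral_extension to sigma tau.
Hypothesis sigma1 : forall g x y, sigma g x y = 1.
Let A := cocentral to sigma tau.
Let hopf : is_hopf A := cocentral_hopf hH.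

Lemma hcomul_dl g x : hcomul A (dl k (g, x)) =
  \sum_h tau h (h^-1 * g)%g x *: dl k ((h, x), ((h^-1 * g)%g, x)).
Proof.
by rewrite /hcomul ext_dl; apply: eq_bigr => h _; rewrite ten_dl.
Qed.

Lemma bcomulE g x h l : bcomul A (g, x) ((h, x), (l, x)) =
  tau h l x *+ (h * l == g)%g.
Proof.
rewrite -[bcomul A _](ext_dl (bcomul A)) -/(hcomul A) hcomul_dl.
rewrite sum_ffunE (bigD1 h) //= big1 => [|h' /negPf nh].
  rewrite !ffunE !xpair_eqE !eqxx /=.
  rewrite [LHS]addr0 andbT -(inj_eq (mulgI h)) mulKVg.
  case: eqP => [<-|_]; last exact: mulr0.
  by rewrite mulKg; apply: mulr1.
rewrite !ffunE !xpair_eqE [h == _]eq_sym nh; exact: mulr0.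
Qed.

Lemma tau1l g x : tau 1%g g x = 1.
Proof.
have /ffunP/(_ (g, x)) := hopf_counitl hopf (dl k (g, x)).
rewrite hcomul_dl linear_sum sum_ffunE (bigD1 1%g) //= big1 => [|h /negPf nh].
  rewrite linearZ /= ext_dl /= eqxx scale1r invg1 mul1g addr0 !ffunE eqxx => e.
  by rewrite -[LHS]mulr1; exact: e.
by rewrite linearZ /= ext_dl /= nh scale0r scaler0 ffunE.
Qed.

Lemma tau1r g x : tau g 1%g x = 1.
Proof.
have /ffunP/(_ (g, x)) := hopf_counitr hopf (dl k (g, x)).
rewrite hcomul_dl linear_sum sum_ffunE (bigD1 g) //= big1 => [|h /negPf nh].
  rewrite linearZ /= ext_dl /= mulVg eqxx scale1r addr0 !ffunE eqxx => e.
  by rewrite -[LHS]mulr1; exact: e.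
rewrite linearZ /= ext_dl /= -eq_mulVg1 nh.
by rewrite scale0r scaler0 ffunE.
Qed.

(** This is coassociativity on [p_(ghl) # x], read at the coefficient indexed by [g], [h], [l]. *)
Lemma tau_cocycle g h l x :
  tau g h x * tau (g * h)%g l x = tau g (h * l)%g x * tau h l x.
Proof.
have := hopf_comulA hopf (dl k ((g * h * l)%g, x)) (g, x) (h, x) (l, x).
rewrite hcomul_dl /ften !linear_sum !sum_ffunE.
rewrite (bigD1 (g * h)%g) //= [X in _ + X]big1 => [|q /negPf nq]; last first.
  rewrite linearZ /= ext_dl /= [LHS]ffunE ffunE /= [X in _ *: (X * _)]bcomulE.
  by rewrite eq_sym nq mulr0n mul0r scaler0.
rewrite (bigD1 g) //= [X in _ = _ + X]big1 => [|q /negPf nq]; last first.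
  rewrite linearZ /= ext_dl /= [LHS]ffunE ffunE /=.
  by rewrite [dl _ _ _]ffunE xpair_eqE eq_sym nq mul0r scaler0.
rewrite !linearZ /= !ext_dl /= ![_ + 0]addr0.
rewrite mulKg -!(mulgA g h l) mulKg !ffunE /= !eqxx.
rewrite [X in _ *: (X * _)]bcomulE [X in _ = _ *: (_ * X)]bcomulE.
rewrite !eqxx mulr1 mul1r [LHS]mulrC => e.
exact: e.
Qed.

Lemma tau_1 g h : tau g h 1%g = 1.
Proof.
have boneE q : bone A (q, 1%g) = 1.
  rewrite /= sum_ffunE (bigD1 q) //= big1 => [|q' /negPf nq].
    by rewrite addr0 ffunE eqxx.
  by rewrite ffunE xpair_eqE eq_sym nq.
have /ffunP/(_ ((g, 1%g), (h, 1%g))) := hopf_comul1 hopf.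
rewrite [RHS]ffunE !boneE mulr1 /hcomul [bone A]/= linear_sum sum_ffunE.
rewrite (bigD1 (g * h)%g) //= big1 => [|q /negPf nq]; last first.
  by rewrite ext_dl bcomulE eq_sym nq.
by rewrite ext_dl bcomulE eqxx addr0.
Qed.

Lemma bmulE p x q y : bmul A (p, x) (q, y) =
  if p == lact to x q then dl k (p, (x * y)%g) else 0.
Proof. by rewrite /= sigma1 scale1r. Qed.

Lemma hmul2_sum (I J : finType) (P : I -> (gT * lT) * (gT * lT))
    (Q : J -> (gT * lT) * (gT * lT)) (a : I -> k) (b : J -> k) :
  hmul2 A (\sum_i a i *: dl k (P i)) (\sum_j b j *: dl k (Q j)) =
  \sum_i \sum_j (a i * b j) *:
    ten (bmul A (P i).1 (Q j).1) (bmul A (P i).2 (Q j).2).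
Proof.
rewrite /hmul2 linear_sum; apply: eq_bigr => i _.
rewrite linearZ /= ext_dl [ext _ (\sum_j _)]linear_sum scaler_sumr.
by apply: eq_bigr => j _; rewrite linearZ /= ext_dl scalerA.
Qed.

(** Multiplicativity of the coproduct is applied to [p_(gh) # x] and [p_q # y], where
    [q = x^-1.(gh)] is the choice that makes the product nonzero; the coefficient at [g], [h] is
    compared. *)
Lemma tauM g h x y :
  tau g h (x * y)%g = tau g h x * tau (lact to x^-1 g) (lact to x^-1 h) y.
Proof.
have lactVK q : lact to x (lact to x^-1 q) = q.
  by rewrite -lactM mulgV lact1.
have /ffunP/(_ ((g, (x * y)%g), (h, (x * y)%g))) :=
  hopf_comulM hopf (dl k ((g * h)%g, x)) (dl k (lact to x^-1 (g * h), y)).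
rewrite /hmul /tenmul ten_dl ext_dl [fst _]/= [snd _]/= bmulE lactVK eqxx.
rewrite [hcomul A (dl k (_, (x * y)%g))]ext_dl bcomulE eqxx mulr1n => ->.
rewrite !hcomul_dl hmul2_sum sum_ffunE.
rewrite (bigD1 g) //= [X in _ + X]big1 => [|q /negPf nq]; last first.
  rewrite sum_ffunE big1 // => r _; rewrite !ffunE /= !sigma1 !scale1r.
  by case: eqP => _; rewrite ffunE ?xpair_eqE 1?eq_sym ?nq mul0r scaler0.
rewrite mulKg [LHS]addr0 sum_ffunE.
rewrite (bigD1 (lact to x^-1 g)) //= [X in _ + X]big1 => [|q nq]; last first.
  rewrite !ffunE /= !sigma1 !scale1r.
  case: eqP => [e|_]; last by rewrite ffunE mul0r scaler0.
  by case/eqP: nq; rewrite e -lactM mulVg lact1.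
rewrite !ffunE /= !sigma1 !scale1r.
rewrite -lactV -lactMg mulKg !lactVK !eqxx !ffunE !eqxx.
rewrite [LHS]addr0 mulr1; exact: mulr1.
Qed.

(** The cocycle identity at [g, g^-1, g] has its other two factors equal to 1 by normalization. *)
Lemma tau_sym g x : tau g (g^-1)%g x = tau (g^-1)%g g x.
Proof.
have := tau_cocycle g (g^-1)%g g x.
by rewrite mulgV mulVg tau1l tau1r mulr1 mul1r.
Qed.

(** Write [t_h] for [tau h h^-1]. Two uses of [tauM] expand the left side as
    [t_(xg)(x) t_g(z) t_(z^-1 g)(x^-1)]. Since [z^-1 g] is [g] or [g^-1], [tau_sym] turns the last
    factor into [t_g(x^-1)], which cancels the first because [t_(xg)(x x^-1) = 1]. *)
Lemma tau_conj g x z : lact to z g = g \/ lact to z g = (g^-1)%g ->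
  tau (lact to x g) (lact to x g)^-1%g (z ^ x^-1)%g = tau g (g^-1)%g z.
Proof.
move=> zg; have lactK' q : lact to x^-1 (lact to x q) = q by apply: lactK.
rewrite conjgE invgK mulgA tauM tauM -!lactV !lactK'.
have -> : tau (lact to (x * z)^-1 (lact to x g))
    (lact to (x * z)^-1 (lact to x g^-1)) x^-1 = tau g g^-1%g x^-1%g.
  rewrite invMg !lactM !lactK'.
  case: zg => zg.
    have e : lact to z^-1 g = g by rewrite -{1}zg lactK.
    by rewrite lactV e.
  have e : lact to z^-1 g = (g^-1)%g.
    by rewrite -{1}[g]invgK -zg -lactV lactK.
  by rewrite lactV e invgK -tau_sym.
have := tauM (lact to x g) (lact to x g^-1) x x^-1.
by rewrite mulgV tau_1 !lactK' mulrAC => <-; rewrite mul1r.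
Qed.

End TauIdentities.

(** * Averages in group algebras, and linearity of traces, Sweedler squares and characters *)

Lemma falg_eval_gavg (k : fieldType) (lT : finGroupType) (f : lT -> k)
    (S : {set lT}) :
  falg_eval f (gavg k S) = #|S|%:R^-1 * \sum_(z in S) f z.
Proof.
rewrite /falg_eval /gavg scaler_sumr linear_sum mulr_sumr.
by apply: eq_bigr => z _; rewrite linearZ /= ext_dl.
Qed.

Lemma lftrace_linear (k : fieldType) (W : vectType k) :
  linear (@lftrace k W : 'End(W) -> k^o).
Proof.
move=> a u v; rewrite /lftrace scaler_sumr -big_split /=.
by apply: eq_bigr => i _; rewrite add_lfunE scale_lfunE linearP.
Qed.
HB.instance Definition _ (k : fieldType) (W : vectType k) :=
  GRing.isSemilinear.Build k _ k^o _ (@lftrace k W)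
    (GRing.semilinear_linear (@lftrace_linear k W)).

Lemma ind_charE (k : fieldType) (lT : finGroupType) (S T : {group lT}) n
    (rV : mx_representation k S n) x :
    #|S|%:R != 0 :> k -> S \subset T -> x \in T ->
  ind_char T rV x =
  #|S|%:R^-1 * \sum_(y in T | (x ^ y)%g \in S) rep_char rV (x ^ y)%g.
Proof.
move=> nzS sST xT; rewrite /ind_char /ind_act lftrace_tensor_map //.
by congr (_ * _); apply: eq_bigr => y _; rewrite mul1r.
Qed.

Lemma sweedler_square_linear (k : fieldType) (B : finType)
    (A : bialg_data k B) : linear (sweedler_square A).
Proof.
by move=> a u v; rewrite /sweedler_square /hcomul /tenmul linearP linearP.
Qed.
HB.instance Definition _ (k : fieldType) (B : finType) (A : bialg_data k B) :=
  GRing.isSemilinear.Build k _ _ _ (sweedler_square A)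
    (GRing.semilinear_linear (sweedler_square_linear A)).

Lemma hat_char_linear (k : fieldType) (gT lT : finGroupType)
    (to : groupAction [set: lT] [set: gT]) (g : gT) n
    (rV : mx_representation k (stab_group to g) n) :
  linear (hat_char rV : _ -> k^o).
Proof.
move=> a u v; apply: etrans (lftrace_linear a _ _).
exact: (congr1 _ (ext_linear _ a u v)).
Qed.
HB.instance Definition _ (k : fieldType) (gT lT : finGroupType)
    (to : groupAction [set: lT] [set: gT]) (g : gT) n
    (rV : mx_representation k (stab_group to g) n) :=
  GRing.isSemilinear.Build k _ k^o _ (hat_char rV)
    (GRing.semilinear_linear (hat_char_linear rV)).

(** * The indicator and the induced-character term as sums over subsets of [L] *)

Section Indicator.
Variables (k : fieldType) (gT lT : finGroupType).
Variable to : groupAction [set: lT] [set: gT].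
Variables (sigma : gT -> lT -> lT -> k) (tau : gT -> gT -> lT -> k).
Hypothesis hH : cocentral_extension to sigma tau.
Hypothesis sigma1 : forall g x y, sigma g x y = 1.
Hypothesis L_neq0 : #|lT|%:R != 0 :> k.
Variables (g : gT) (n : nat) (rV : mx_representation k (stab_group to g) n).
Hypothesis stab_neq0 : #|stab to g|%:R != 0 :> k.
Let chi := rep_char rV.
Let tau_g := tau g (g^-1)%g.

Lemma hat_char_dl h x : hat_char rV (dl k (h, x)) =
  #|stab to g|%:R^-1 * \sum_(y | (x ^ y)%g \in stab to g)
     (lact to (x * y) g == h)%:R * chi (x ^ y)%g.
Proof.
rewrite /hat_char /hat_act ext_dl /hat_act_basis.
rewrite lftrace_tensor_map ?subsetT ?inE // => [|y z].
  congr (_ * _); apply: eq_big => y; first by rewrite inE.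
  by rewrite subgK ?inE.
rewrite inE => /eqP zg /=.
by rewrite subgK ?inE // mulgA [in LHS]lactM zg.
Qed.

Lemma sweedler_square_dl h x :
  sweedler_square (cocentral to sigma tau) (dl k (h, x)) =
  \sum_q tau q (q^-1 * h)%g x *:
    (if q == lact to x (q^-1 * h) then dl k (q, (x * x)%g) else 0).
Proof.
rewrite /sweedler_square hcomul_dl /tenmul linear_sum.
by apply: eq_bigr => q _; rewrite linearZ /= ext_dl /= sigma1 scale1r.
Qed.

Lemma schur_indicator_hat Lam :
    normalized_integral (cocentral to sigma tau) Lam ->
  schur_indicator (cocentral to sigma tau) Lam (hat_char rV) =
  #|stab to g|%:R^-1 *
    \sum_(z in transporter to g (g^-1)%g) conv tau_g (adams2 chi) z.
Proof.
move=> hLam; rewrite (normalized_integral_uniq hLam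
  (cocentral_integral _ _ sigma1 L_neq0)).
(* The coproduct of [p_1 # x] pairs [q] with [q^-1]; multiplying the two legs leaves [p_q # x^2]
   when [q = x.q^-1] and 0 otherwise. *)
transitivity (#|lT|%:R^-1 * \sum_x \sum_q tau q q^-1%g x *
    ((q == lact to x q^-1)%:R * hat_char rV (dl k (q, (x * x)%g)))).
  pose chiL : {linear _ -> k^o} := hat_char rV.
  rewrite /schur_indicator scaler_sumr [sweedler_square _ _]linear_sum.
  rewrite (linear_sum chiL) mulr_sumr; apply: eq_bigr => x _.
  rewrite linearZ /= (linearZ_LR chiL) sweedler_square_dl (linear_sum chiL).
  apply: (congr1 ( *%R _)); apply: eq_bigr => q _.
  rewrite mulg1 (linearZ_LR chiL); apply: (congr1 ( *%R _)).
  by case: eqP => _; rewrite ?mul1r // (linear0 chiL) mul0r.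
(* If [x^2] conjugated by [y] fixes [g], then [x^2 y] and [y] send [g] to the same element, so the
   sum over [q] collapses to [q = y.g]. *)
transitivity (#|lT|%:R^-1 * \sum_x (#|stab to g|%:R^-1 *
    \sum_(y | ((x * x) ^ y)%g \in stab to g)
      (lact to y g == lact to x (lact to y g)^-1)%:R *
      (tau (lact to y g) (lact to y g)^-1%g x * chi ((x * x) ^ y)%g))).
  congr (_ * _); apply: eq_bigr => x _.
  under eq_bigr do rewrite hat_char_dl mulrA mulrCA.
  rewrite -mulr_sumr; congr (_ * _).
  under eq_bigr do rewrite mulr_sumr.
  rewrite exchange_big; apply: eq_bigr => y; rewrite inE => /eqP xyg.
  have xxg : lact to (x * x * y) g = lact to y g.
    by rewrite conjgC lactM xyg.
  rewrite xxg (bigD1 (lact to y g)) //= big1 => [|q /negPf nq]; last first.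
    by rewrite [_ == q]eq_sym nq mul0r mulr0.
  by rewrite eqxx mul1r addr0 -mulrA mulrCA.
rewrite -mulr_sumr mulrCA; congr (_ * _).
transitivity (#|lT|%:R^-1 * \sum_(y : lT)
    \sum_(z in transporter to g (g^-1)%g) conv tau_g (adams2 chi) z); last first.
  by rewrite sumr_const -[X in _ * X]mulr_natl mulrA mulVf ?mul1r.
congr (_ * _); under eq_bigr do rewrite big_mkcond.
rewrite exchange_big; apply: eq_bigr => y _.
(* With [x = y z y^-1] the condition on [x] becomes [z.g = g^-1], which already forces [z^2] to fix
   [g]; [tau_conj] then removes [y] from the summand. *)
rewrite (reindex_inj (conjg_inj y^-1%g)) [RHS]big_mkcond; apply: eq_bigr => z _.
rewrite -conjMg conjgKV !inE.
have -> : (lact to y g == lact to (z ^ y^-1) (lact to y g)^-1)%g =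
    (lact to z g == g^-1)%g.
  rewrite conjgE invgK mulgA !lactM -lactV lactK (can_eq (lactK to y)).
  by rewrite lactV eq_sym eqg_invLR.
have [zg|_] := eqVneq (lact to z g) (g^-1)%g; last by rewrite mul0r if_same.
rewrite lactM zg lactV zg invgK eqxx mul1r (tau_conj hH sigma1) //.
by right.
Qed.

(** The induced character is itself a sum over conjugators [y] in [X]. Conjugating [z] back shows
    that all of them contribute equally, so [#|X|] cancels and only the inverse order of the
    stabilizer is left. *)
Lemma falg_eval_ind_char_xstab (X := xstab to g) :
  #|X|%:R != 0 :> k ->
  falg_eval (conv tau_g (adams2 (ind_char (xstab_group to g) rV))) (gavg k X)
  = #|stab to g|%:R^-1 * \sum_(z in X) conv tau_g (adams2 chi) z.
Proof.
move=> nzX; rewrite falg_eval_gavg.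
(* Squares land in the stabilizer, so the support condition of the induced character formula is
   vacuous here. *)
have sqS z : z \in X -> (z ^+ 2)%g \in stab to g.
  rewrite !inE expgS expg1 lactM => /orP[] /eqP zg; rewrite zg ?zg //.
  by rewrite lactV zg invgK.
have ind_sq z : z \in X ->
    ind_char (xstab_group to g) rV (z ^+ 2)%g =
    #|stab to g|%:R^-1 * \sum_(y in X) chi ((z ^ y) ^+ 2)%g.
  move=> zX; rewrite ind_charE ?stab_sub_xstab //; last exact: groupX.
  congr (_ * _); apply: eq_big => y; last by rewrite conjXg.
  case yX: (y \in X) => //=; rewrite conjXg sqS //.
  by rewrite (@groupJr _ (xstab_group to g)).
transitivity (#|X|%:R^-1 * (#|stab to g|%:R^-1 * \sum_(y in X)
    \sum_(z in X) conv tau_g (adams2 chi) z)); last first.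
  by rewrite sumr_const -[X in _ * (_ * X)]mulr_natl mulrCA mulKf.
congr (_ * _).
under eq_bigr => z zX do rewrite /conv /adams2 ind_sq // mulrCA mulr_sumr.
rewrite -mulr_sumr; congr (_ * _); rewrite exchange_big /=.
apply: eq_bigr => y yX; rewrite (reindex_inj (conjg_inj y^-1%g)).
have yVX : y^-1%g \in xstab_group to g by rewrite groupV.
apply: eq_big => z; rewrite (groupJr _ yVX) // => zX; rewrite conjgKV.
congr (_ * _).
have zg : lact to z g = g \/ lact to z g = (g^-1)%g.
  by move: zX; rewrite !inE => /orP[] /eqP; [left | right].
rewrite /tau_g -[RHS](tau_conj hH sigma1 y zg).
(* When [y] inverts [g], [tau_conj] yields [tau] at [g^-1, g], and symmetry brings it back. *)
move: yX; rewrite !inE => /orP[] /eqP -> //.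
by rewrite invgK (tau_sym hH).
Qed.

End Indicator.

Theorem theorem5p1 (k : closedFieldType) (gT lT : finGroupType)
    (char_k : 2%N \notin [pchar k])
    (char_GL : [pchar k]^'.-nat (#|gT| * #|lT|)%N)
    (to : groupAction [set: lT] [set: gT])
    (sigma : gT -> lT -> lT -> k) (tau : gT -> gT -> lT -> k)
    (hH : cocentral_extension to sigma tau)
    (sigma_trivial : forall g x y, sigma g x y = 1)
    (Lam : freemod k (gT * lT)%type)
    (hLam : normalized_integral (cocentral to sigma tau) Lam)
    (g : gT) (n : nat) (rV : mx_representation k (stab_group to g) n)
    (simpleV : mx_irreducible rV) :
  let nu := schur_indicator (cocentral to sigma tau) Lam in
  let tau_g := tau g (g^-1)%g in
  let chi := rep_char rV in
  let chi_tilde := ind_char (xstab_group to g) rV in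
  let chi_hat := hat_char rV in
  ((g ^+ 2)%g = 1%g ->
     nu chi_hat =
     falg_eval (conv tau_g (adams2 chi)) (gavg k (stab to g))) /\
  ((3 <= #[g]%g)%N ->
     nu chi_hat =
     falg_eval (conv tau_g (adams2 chi_tilde)) (gavg k (xstab to g)) -
     falg_eval (conv tau_g (adams2 chi)) (gavg k (stab to g))).
Proof.
move=> nu tau_g chi chi_tilde chi_hat.
have L_nat : [pchar k]^'.-nat #|lT| by move: char_GL; rewrite pnatM => /andP[].
have L_neq0 : #|lT|%:R != 0 :> k by rewrite natf_neq0_pchar.
have sub_neq0 (K : {group lT}) : #|K|%:R != 0 :> k.
  by rewrite natf_neq0_pchar (pnat_dvd _ L_nat) // -cardsT cardSg ?subsetT.
have stab_neq0 := sub_neq0 (stab_group to g).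
have nuE := schur_indicator_hat hH sigma_trivial L_neq0 rV stab_neq0 hLam.
split=> [g2 | g3].
  rewrite /nu nuE falg_eval_gavg; congr (_ * _); apply: eq_bigl => z.
  suff -> : (g^-1 = g)%g by [].
  by apply: (mulgI g); rewrite mulgV -g2.
(* This makes the two pieces of the extended stabilizer disjoint, so subtracting the sum over the
   stabilizer leaves exactly the transporter sum. *)
have gV : g != (g^-1)%g.
  apply/eqP => e; have : (#[g]%g %| 2)%N.
    by rewrite order_dvdn expgS expg1 {2}e mulgV.
  by move/dvdn_leq => /(_ isT); rewrite leqNgt g3.
have xstab_neq0 := sub_neq0 (xstab_group to g).
rewrite /nu nuE.
rewrite (falg_eval_ind_char_xstab hH sigma_trivial rV stab_neq0 xstab_neq0).
rewrite falg_eval_gavg -mulrBr; congr (_ * _).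
have disj : [disjoint stab to g & transporter to g g^-1].
  rewrite -setI_eq0; apply/eqP/setP => z; rewrite !inE.
  by case: eqP => // ->; rewrite (negPf gV).
rewrite [X in _ = X - _](eq_bigl
  [in [predU stab to g & transporter to g g^-1]]) => [|z].
  by rewrite bigU //= addrAC subrr add0r.
by rewrite !inE.
Qed.
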